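(* Let $n\ge 2$, let $\alpha_i=\langle\mu_{\alpha_i},\eta_{\alpha_i},\nu_{\alpha_i}\rangle$ ($i=1,\dots,n$) be picture fuzzy numbers, let $T$ be a strict t-norm with additive generator $\tau$, and let $\zeta(x)=\tau(1-x)$. Then for all $p,q>0$, $\mathrm{PFIBM}_T^{p,q}(\alpha_1,\dots,\alpha_n)$ is a picture fuzzy number, and $$\mathrm{PFIBM}_T^{p,q}(\alpha_1,\dots,\alpha_n)=\Big\langle \tau^{-1}\big(\tfrac{1}{p+q}\tau(\mu)\big),\ \tau^{-1}\big(\tfrac1{p+q}\tau(\eta+\mu)\big)-\tau^{-1}\big(\tfrac1{p+q}\tau(\mu)\big),\ \zeta^{-1}\big(\tfrac1{p+q}\zeta(\nu)\big)\Big\rangle,$$ where (all sums being over ordered pairs $(i,j)$ with $1\le i,j\le n$, $i\ne j$) $$\mu=\zeta^{-1}\Big(\tfrac1{n(n-1)}\sum_{i\ne j}\zeta\big(\tau^{-1}(p\,\tau(\mu_{\alpha_i})+q\,\tau(\mu_{\alpha_j}))\big)\Big),$$ $$\eta=\tau^{-1}\Big(\tfrac1{n(n-1)}\sum_{i\ne j}\tau\big(\tau^{-1}(p\,\tau(\eta_{\alpha_i}+\mu_{\alpha_i})+q\,\tau(\eta_{\alpha_j}+\mu_{\alpha_j}))-\tau^{-1}(p\,\tau(\mu_{\alpha_i})+q\,\tau(\mu_{\alpha_j}))+\zeta^{-1}(p\,\zeta(\nu_{\alpha_i})+q\,\zeta(\nu_{\alpha_j}))\big)\Big)-\tau^{-1}\Big(\tfrac1{n(n-1)}\sum_{i\ne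 j}\tau\big(\zeta^{-1}(p\,\zeta(\nu_{\alpha_i})+q\,\zeta(\nu_{\alpha_j}))\big)\Big),$$ $$\nu=\tau^{-1}\Big(\tfrac1{n(n-1)}\sum_{i\ne j}\tau\big(\zeta^{-1}(p\,\zeta(\nu_{\alpha_i})+q\,\zeta(\nu_{\alpha_j}))\big)\Big).$$
   Context: A picture fuzzy number (PFN) is a triple $\alpha=\langle\mu,\eta,\nu\rangle$ with $\mu,\eta,\nu\in[0,1]$ and $\mu+\eta+\nu\le1$. A t-norm is a commutative, associative map $T:[0,1]^2\to[0,1]$, nondecreasing in each variable, with $T(1,x)=x$. It is strict if it is continuous and $T(x,y)<T(x,z)$ whenever $x>0$ and $y<z$. A strict t-norm has a continuous additive generator: a continuous strictly decreasing bijection $\tau:[0,1]\to[0,+\infty]$ with $\tau(1)=0$, $\tau(0)=+\infty$ and $T(x,y)=\tau^{-1}(\tau(x)+\tau(y))$. Its dual t-conorm is $S(x,y)=1-T(1-x,1-y)=\zeta^{-1}(\zeta(x)+\zeta(y))$, where $\zeta(x)=\tau(1-x)$. Arithmetic in $[0,+\infty]$ is the usual one ($a+\infty=\infty$, $\lambda\cdot\infty=\infty$ for $\lambda>0$). For a strict t-norm $T$, PFNs $\alpha_k=\langle\mu_k,\eta_k,\nu_k\rangle$ ($k=1,2$), $\alpha=\langle\mu,\eta,\nu\rangle$ and $\lambda>0$ define: $\alpha_1\oplus\alpha_2=\langle S(\mu_1,\mu_2),\,T(\eta_1+\nu_1,\eta_2+\nu_2)-T(\nu_1,\nu_2),\,T(\nu_1,\nu_2)\rangle$;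 $\alpha_1\otimes\alpha_2=\langle T(\mu_1,\mu_2),\,T(\eta_1+\mu_1,\eta_2+\mu_2)-T(\mu_1,\mu_2),\,S(\nu_1,\nu_2)\rangle$; $\lambda\cdot\alpha=\langle\zeta^{-1}(\lambda\zeta(\mu)),\,\tau^{-1}(\lambda\tau(\eta+\nu))-\tau^{-1}(\lambda\tau(\nu)),\,\tau^{-1}(\lambda\tau(\nu))\rangle$; $\alpha^\lambda=\langle\tau^{-1}(\lambda\tau(\mu)),\,\tau^{-1}(\lambda\tau(\eta+\mu))-\tau^{-1}(\lambda\tau(\mu)),\,\zeta^{-1}(\lambda\zeta(\nu))\rangle$. These operations send PFNs to PFNs, and $\oplus,\otimes$ are commutative and associative (known facts), so iterated $\bigoplus$ is well defined. For $p,q>0$ the picture fuzzy interactional Bonferroni mean induced by $T$ is $$\mathrm{PFIBM}_T^{p,q}(\alpha_1,\dots,\alpha_n)=\Big[\tfrac1{n(n-1)}\cdot\bigoplus_{i,j=1,\ i\ne j}^n(\alpha_i^p\otimes\alpha_j^q)\Big]^{\frac1{p+q}}.$$ *)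

(* Defs.v *)
From HB Require Import structures.
From mathcomp Require Import all_boot all_order all_algebra.
From mathcomp Require Import all_classical all_reals all_analysis.

Set Implicit Arguments.
Unset Strict Implicit.
Unset Printing Implicit Defensive.

Import Order.TTheory GRing.Theory Num.Theory.
Import numFieldNormedType.Exports.

Local Open Scope classical_set_scope.
Local Open Scope ring_scope.

(* Triples carry no constraint, so that being a picture fuzzy number is a
   property that has to be proved of the result of an operation. *)
Record pftriple (R : Type) := PFTriple { pf_mu : R; pf_eta : R; pf_nu : R }.

Definition is_pfn (R : realType) (a : pftriple R) : Prop :=
  [/\ pf_mu a \in `[0, 1], pf_eta a \in `[0, 1], pf_nu a \in `[0, 1]
    & pf_mu a + pf_eta a + pf_nu a <= 1].

(* A map [0,1]^2 -> [0,1] is represented by a function on R whose values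
   outside [0,1]^2 are unconstrained. *)
Record tnorm (R : realType) (T : R -> R -> R) : Prop := TNorm {
  tnorm_itv : forall x y, x \in `[0, 1] -> y \in `[0, 1] -> T x y \in `[0, 1];
  tnormC : {in `[0, 1] &, commutative T};
  tnormA : {in `[0, 1] & &, associative T};
  tnorm_lel : forall x y z, x \in `[0, 1] -> y \in `[0, 1] -> z \in `[0, 1] ->
    y <= z -> T y x <= T z x;
  tnorm_ler : forall x y z, x \in `[0, 1] -> y \in `[0, 1] -> z \in `[0, 1] ->
    y <= z -> T x y <= T x z;
  tnorm1x : {in `[0, 1], left_id 1 T} }.

Record strict_tnorm (R : realType) (T : R -> R -> R) : Prop := StrictTNorm {
  strict_tnorm_tnorm : tnorm T;
  strict_tnorm_continuous :
    {within `[0, 1] `*` `[0, 1], continuous (fun xy : R * R => T xy.1 xy.2)};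
  strict_tnorm_lt : forall x y z,
    x \in `[0, 1] -> y \in `[0, 1] -> z \in `[0, 1] ->
    0 < x -> y < z -> T x y < T x z }.

(* The inverse [0,+oo] -> [0,1] of a bijection [0,1] -> [0,+oo]; its values at
   negative extended reals (the default 0) are irrelevant. *)
Definition inv01 (R : realType) (f : R -> \bar R) : \bar R -> R :=
  'pinv_(fun=> 0) `[0, 1] f.

Record additive_generator (R : realType) (T : R -> R -> R) (tau : R -> \bar R) :
    Prop := AdditiveGenerator {
  generator_continuous : {within `[0, 1], continuous tau};
  generator_decr : {in `[0, 1] &, forall x y, x < y -> (tau y < tau x)%E};
  generator_bij : set_bij `[0, 1] [set y | (0 <= y)%E] tau;
  generator1 : tau 1 = 0%E;
  generator0 : tau 0 = +oo%E;
  generatorE :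
    {in `[0, 1] &, forall x y, T x y = inv01 tau (tau x + tau y)%E} }.

Definition dual_generator (R : realType) (tau : R -> \bar R) (x : R) : \bar R :=
  tau (1 - x).

Definition dual_tconorm (R : realType) (T : R -> R -> R) (x y : R) : R :=
  1 - T (1 - x) (1 - y).

Section Operations.
Variables (R : realType) (T : R -> R -> R) (tau : R -> \bar R).
Let S := dual_tconorm T.
Let zeta := dual_generator tau.
Let tau' := inv01 tau.
Let zeta' := inv01 zeta.

Definition pf_add (a b : pftriple R) : pftriple R :=
  PFTriple (S (pf_mu a) (pf_mu b))
    (T (pf_eta a + pf_nu a) (pf_eta b + pf_nu b) - T (pf_nu a) (pf_nu b))
    (T (pf_nu a) (pf_nu b)).

Definition pf_mul (a b : pftriple R) : pftriple R :=
  PFTriple (T (pf_mu a) (pf_mu b))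
    (T (pf_eta a + pf_mu a) (pf_eta b + pf_mu b) - T (pf_mu a) (pf_mu b))
    (S (pf_nu a) (pf_nu b)).

Definition pf_scale (l : R) (a : pftriple R) : pftriple R :=
  PFTriple (zeta' (l%:E * zeta (pf_mu a))%E)
    (tau' (l%:E * tau (pf_eta a + pf_nu a))%E - tau' (l%:E * tau (pf_nu a))%E)
    (tau' (l%:E * tau (pf_nu a))%E).

Definition pf_pow (a : pftriple R) (l : R) : pftriple R :=
  PFTriple (tau' (l%:E * tau (pf_mu a))%E)
    (tau' (l%:E * tau (pf_eta a + pf_mu a))%E - tau' (l%:E * tau (pf_mu a))%E)
    (zeta' (l%:E * zeta (pf_nu a))%E).

End Operations.

Section BonferroniMean.
Variables (R : realType) (T : R -> R -> R) (tau : R -> \bar R).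

Definition pf_zero : pftriple R := PFTriple 0 0 1.

(* The neutral element in the iterated sum below is harmless: it disappears
   when added to a picture fuzzy number. *)
Lemma pf_addr0 (a : pftriple R) : tnorm T -> is_pfn a -> pf_add T a pf_zero = a.
Proof.
case: a => m e v Tn [/= m01 e01 v01 mev].
have T1 x : x \in `[0, 1] -> T x 1 = x.
  by move=> x01; rewrite (tnormC Tn) ?(tnorm1x Tn)// in_itv/= ler01 lexx.
have ev01 : e + v \in `[0, 1].
  move: m01 e01 v01; rewrite !in_itv/= => /andP[m0 _] /andP[e0 _] /andP[v0 _].
  by rewrite addr_ge0//= (le_trans _ mev)// -addrA lerDr.
have m'01 : 1 - m \in `[0, 1].
  move: m01; rewrite !in_itv/= => /andP[m0 m1].
  by rewrite subr_ge0 m1/= gerBl.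
rewrite /pf_add /dual_tconorm /= add0r subr0 !T1//.
by rewrite subKr addrK.
Qed.

Definition pfibm (n : nat) (p q : R) (a : 'I_n -> pftriple R) : pftriple R :=
  pf_pow tau
    (pf_scale tau (n * n.-1)%:R^-1
      (\big[pf_add T/pf_zero]_(ij : 'I_n * 'I_n | ij.1 != ij.2)
         pf_mul T (pf_pow tau (a ij.1) p) (pf_pow tau (a ij.2) q)))
    (p + q)^-1.

End BonferroniMean.

(* Main.v *)
(** In the coordinates [(1 - mu, eta + nu, nu)], a picture fuzzy number is a
    decreasing triple of points of [0,1], and [pf_add] and [pf_scale] act on each
    coordinate through the nondecreasing maps [T] and
    [x |-> tau^-1 (l * tau x)]; the coordinates [(1 - nu, eta + mu, mu)] play
    the same role for [pf_mul] and [pf_pow]. Monotonicity gives closure, and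
    applying [tau] coordinatewise turns the iterated sum into a sum of extended
    reals. *)
Require Import Defs.
From mathcomp Require Import all_boot all_order all_algebra.
From mathcomp Require Import all_classical all_reals all_analysis.
From mathcomp Require Import lra.

Import Order.TTheory GRing.Theory Num.Theory.

Local Open Scope ring_scope.

Section Generator.
Set Implicit Arguments.
Unset Strict Implicit.
Variables (R : realType) (T : R -> R -> R) (tau : R -> \bar R).
Hypothesis htau : additive_generator T tau.

Lemma itv01_compl (x : R) : x \in `[0, 1] -> 1 - x \in `[0, 1].
Proof. by rewrite !in_itv/= subr_ge0 gerBl => /andP[-> ->]. Qed.

Lemma generator_ge0 (x : R) : x \in `[0, 1] -> (0 <= tau x)%E.
Proof. by move=> x01; have [/(_ x x01)] := generator_bij htau. Qed.

Lemma generatorK (x : R) : x \in `[0, 1] -> inv01 tau (tau x) = x.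
Proof.
move=> x01; have [_ tau_inj _] := generator_bij htau.
by rewrite /inv01 pinvKV ?inE.
Qed.

(** Surjectivity of [tau] lets a nonnegative [y] be replaced by some [tau x]; [generatorK] then
    gives both the range of [inv01 tau] and the right-inverse law. *)
Lemma inv01_ex (y : \bar R) : (0 <= y)%E ->
  exists2 x, x \in `[0, 1] & tau x = y.
Proof. by move=> y0; have [_ _ tau_surj] := generator_bij htau; have [x] := tau_surj y y0; exists x. Qed.

Lemma inv01_itv (y : \bar R) : (0 <= y)%E -> inv01 tau y \in `[0, 1].
Proof. by move=> /inv01_ex[x x01 <-]; rewrite generatorK. Qed.

Lemma inv01K (y : \bar R) : (0 <= y)%E -> tau (inv01 tau y) = y.
Proof. by move=> /inv01_ex[x x01 <-]; rewrite generatorK. Qed.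

(** Since zeta is [tau] after [x |-> 1 - x], the point [1 - inv01 tau y] is a preimage of [y], and
    injectivity of zeta on [0,1] makes it the one chosen by [pinv]. From here on zeta is eliminated
    in favour of [tau]. *)
Lemma inv01_dual (y : \bar R) : (0 <= y)%E ->
  inv01 (dual_generator tau) y = 1 - inv01 tau y.
Proof.
move=> y0; have z01 := itv01_compl (inv01_itv y0).
have zinj : {in `[0, 1]%classic &, injective (dual_generator tau)}.
  move=> u v /set_mem u01 /set_mem v01 /(congr1 (inv01 tau)).
  rewrite !generatorK; [|exact: itv01_compl..].
  lra.
have <- : dual_generator tau (1 - inv01 tau y) = y.
  by rewrite /dual_generator subKr inv01K.
by rewrite {1}/inv01 pinvKV ?inE // /dual_generator subKr inv01K.
Qed.

Lemma tnorm_generator (x y : R) : x \in `[0, 1] -> y \in `[0, 1] ->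
  tau (T x y) = (tau x + tau y)%E.
Proof.
move=> x01 y01; rewrite (generatorE htau) //.
by rewrite inv01K // adde_ge0 // generator_ge0.
Qed.

Lemma generator_le (x y : R) : x \in `[0, 1] -> y \in `[0, 1] -> x <= y ->
  (tau y <= tau x)%E.
Proof.
move=> x01 y01; rewrite le_eqVlt => /predU1P[->//|xy].
exact/ltW/(generator_decr htau).
Qed.

Lemma inv01_le (x y : \bar R) : (0 <= x)%E -> (x <= y)%E ->
  inv01 tau y <= inv01 tau x.
Proof.
move=> x0 xy; have y0 := le_trans x0 xy.
rewrite leNgt; apply/negP => lt_xy.
have := generator_decr htau (inv01_itv x0) (inv01_itv y0) lt_xy.
by rewrite !inv01K // ltNge xy.
Qed.

Lemma generator_scale_ge0 (l x : R) : 0 <= l -> x \in `[0, 1] ->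
  (0 <= l%:E * tau x)%E.
Proof. by move=> l0 x01; rewrite mule_ge0 ?lee_fin // generator_ge0. Qed.

Lemma inv01_scale_le (l x y : R) : 0 <= l -> x \in `[0, 1] -> y \in `[0, 1] ->
  x <= y -> inv01 tau (l%:E * tau x)%E <= inv01 tau (l%:E * tau y)%E.
Proof.
move=> l0 x01 y01 xy; apply: inv01_le; first exact: generator_scale_ge0.
by rewrite lee_wpmul2l ?lee_fin // generator_le.
Qed.

Lemma tnorm_le (hT : tnorm T) (x y z t : R) :
  x \in `[0, 1] -> y \in `[0, 1] -> z \in `[0, 1] -> t \in `[0, 1] ->
  x <= z -> y <= t -> T x y <= T z t.
Proof.
move=> x01 y01 z01 t01 xz yt.
exact: le_trans (tnorm_lel hT y01 x01 z01 xz) (tnorm_ler hT z01 y01 t01 yt).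
Qed.

(* Exchanging the roles of [mu] and [nu] conjugates [pf_mul] to [pf_add] and
   [pf_pow] to [pf_scale]. *)
Definition pf_swap (a : pftriple R) : pftriple R :=
  PFTriple (pf_nu a) (pf_eta a) (pf_mu a).

Lemma is_pfn_swap (a : pftriple R) : is_pfn a -> is_pfn (pf_swap a).
Proof. by case=> m01 e01 v01 le1; split=> //=; move: le1; lra. Qed.

Lemma is_pfn_of_chain (x y z : R) : 0 <= z -> z <= y -> y <= x -> x <= 1 ->
  is_pfn (PFTriple (1 - x) (y - z) z).
Proof. by move=> *; split; rewrite ?in_itv /=; lra. Qed.

Lemma is_pfn_chain (a : pftriple R) : is_pfn a ->
  [/\ 1 - pf_mu a \in `[0, 1], pf_eta a + pf_nu a \in `[0, 1],
      pf_nu a \in `[0, 1], pf_nu a <= pf_eta a + pf_nu a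
    & pf_eta a + pf_nu a <= 1 - pf_mu a].
Proof.
case=> m01 e01 v01 le1; move: m01 e01 (v01) le1; rewrite !in_itv /= => *.
by split=> //; lra.
Qed.

Lemma is_pfn_scale (l : R) (a : pftriple R) : 0 <= l -> is_pfn a ->
  is_pfn (pf_scale tau l a).
Proof.
move=> l0 /is_pfn_chain[x01 y01 z01 zy yx].
(* The first component is now [1 - inv01 tau (l * tau (1 - mu))], the form expected by
   [is_pfn_of_chain]. *)
rewrite /pf_scale inv01_dual; last exact: generator_scale_ge0.
have itv u (u01 : u \in `[0, 1]) := inv01_itv (generator_scale_ge0 l0 u01).
have := itv _ z01; have := itv _ x01; rewrite !in_itv /= => /andP[_ x1] /andP[z0 _].
by apply: is_pfn_of_chain => //; apply: inv01_scale_le.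
Qed.

Lemma is_pfn_add (hT : tnorm T) (a b : pftriple R) : is_pfn a -> is_pfn b ->
  is_pfn (pf_add T a b).
Proof.
move=> /is_pfn_chain[x01 y01 z01 zy yx] /is_pfn_chain[x'01 y'01 z'01 zy' yx'].
have := tnorm_itv hT z01 z'01; have := tnorm_itv hT x01 x'01.
rewrite !in_itv /= => /andP[_ x1] /andP[z0 _].
by apply: is_pfn_of_chain => //; apply: tnorm_le.
Qed.

(** [pf_pow tau a l] is convertible to [pf_swap (pf_scale tau l (pf_swap a))]. *)
Lemma is_pfn_pow (l : R) (a : pftriple R) : 0 <= l -> is_pfn a ->
  is_pfn (pf_pow tau a l).
Proof. by move=> l0 /is_pfn_swap/(is_pfn_scale l0)/is_pfn_swap. Qed.

Lemma is_pfn_mul (hT : tnorm T) (a b : pftriple R) : is_pfn a -> is_pfn b ->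
  is_pfn (pf_mul T a b).
Proof.
by move=> /is_pfn_swap ha /is_pfn_swap /(is_pfn_add hT ha)/is_pfn_swap.
Qed.

Lemma is_pfn_zero : is_pfn (pf_zero R).
Proof. by split; rewrite ?in_itv /=; lra. Qed.

(** Closure is proved in the same induction because [tau] turns [T] into addition only on [0,1], so
    each step needs the coordinates of the partial sum to lie there. *)
Lemma generator_sum (hT : tnorm T) (I : Type) (s : seq I) (P : pred I)
    (f : I -> pftriple R) (B := \big[pf_add T/pf_zero R]_(i <- s | P i) f i) :
  (forall i, is_pfn (f i)) ->
  [/\ is_pfn B,
      dual_generator tau (pf_mu B) =
        (\sum_(i <- s | P i) dual_generator tau (pf_mu (f i)))%E,
      tau (pf_eta B + pf_nu B) =
        (\sum_(i <- s | P i) tau (pf_eta (f i) + pf_nu (f i))%R)%E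
    & tau (pf_nu B) = (\sum_(i <- s | P i) tau (pf_nu (f i)))%E].
Proof.
move=> hf; rewrite {}/B; elim: s => [|i s [pfnB muB enB nuB]].
  (* All three coordinates [1 - mu], [eta + nu], [nu] of [pf_zero] equal 1, where [tau] vanishes. *)
  rewrite !big_nil /dual_generator /= subr0 add0r (generator1 htau).
  by split=> //; exact: is_pfn_zero.
rewrite !big_cons; case: (P i) => //; split; first exact: is_pfn_add.
- have [x01 _ _ _ _] := is_pfn_chain (hf i).
  have [x'01 _ _ _ _] := is_pfn_chain pfnB.
  by rewrite -muB /dual_generator /= /dual_tconorm subKr tnorm_generator.
- have [_ y01 _ _ _] := is_pfn_chain (hf i).
  have [_ y'01 _ _ _] := is_pfn_chain pfnB.
  by rewrite -enB /= subrK tnorm_generator.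
- have [_ _ z01 _ _] := is_pfn_chain (hf i).
  have [_ _ z'01 _ _] := is_pfn_chain pfnB.
  by rewrite -nuB /= tnorm_generator.
Qed.

Lemma tnorm_inv01_scale (p q x y : R) : 0 <= p -> 0 <= q ->
  x \in `[0, 1] -> y \in `[0, 1] ->
  T (inv01 tau (p%:E * tau x)%E) (inv01 tau (q%:E * tau y)%E) =
  inv01 tau (p%:E * tau x + q%:E * tau y)%E.
Proof.
move=> p0 q0 x01 y01; have px0 := generator_scale_ge0 p0 x01.
have qy0 := generator_scale_ge0 q0 y01.
by rewrite (generatorE htau) ?inv01_itv // !inv01K.
Qed.

Lemma pf_mul_pow (p q : R) (a b : pftriple R) : 0 <= p -> 0 <= q ->
  is_pfn a -> is_pfn b ->
  let m := inv01 tau (p%:E * tau (pf_mu a) + q%:E * tau (pf_mu b))%E in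
  pf_mul T (pf_pow tau a p) (pf_pow tau b q) =
  PFTriple m
    (inv01 tau (p%:E * tau (pf_eta a + pf_mu a)%R
                + q%:E * tau (pf_eta b + pf_mu b)%R)%E - m)
    (inv01 (dual_generator tau) (p%:E * dual_generator tau (pf_nu a)
                                 + q%:E * dual_generator tau (pf_nu b))%E).
Proof.
move=> p0 q0 /is_pfn_swap/is_pfn_chain[x01 y01 z01 _ _].
move=> /is_pfn_swap/is_pfn_chain[x'01 y'01 z'01 _ _] /=.
have px0 := generator_scale_ge0 p0 x01; have qx0 := generator_scale_ge0 q0 x'01.
(* In [eta + mu] of a power the subtracted term cancels, so [T] is applied to bare values of
   [inv01 tau]. *)
rewrite /pf_mul /= !subrK !tnorm_inv01_scale //; congr PFTriple.
(* Each [nu] of a power becomes a complement, which cancels against the complements inside the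
   t-conorm. *)
rewrite !inv01_dual ?adde_ge0 //.
by rewrite /dual_tconorm !subKr tnorm_inv01_scale.
Qed.

End Generator.

Theorem mainTheorem1 (R : realType) (n : nat) (hn : (2 <= n)%N)
    (a : 'I_n -> pftriple R) (ha : forall i, is_pfn (a i))
    (T : R -> R -> R) (hT : strict_tnorm T)
    (tau : R -> \bar R) (htau : additive_generator T tau)
    (p q : R) (hp : 0 < p) (hq : 0 < q) :
  let zeta := dual_generator tau in
  let tau' := inv01 tau in
  let zeta' := inv01 zeta in
  let c : R := (n * n.-1)%:R^-1 in
  let r : R := (p + q)^-1 in
  let M (ij : 'I_n * 'I_n) : R :=
    tau' (p%:E * tau (pf_mu (a ij.1)) + q%:E * tau (pf_mu (a ij.2)))%E in
  let H (ij : 'I_n * 'I_n) : R :=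
    tau' (p%:E * tau (pf_eta (a ij.1) + pf_mu (a ij.1))%R
          + q%:E * tau (pf_eta (a ij.2) + pf_mu (a ij.2))%R)%E in
  let N (ij : 'I_n * 'I_n) : R :=
    zeta' (p%:E * zeta (pf_nu (a ij.1)) + q%:E * zeta (pf_nu (a ij.2)))%E in
  let mu := zeta' (c%:E *
    \sum_(ij : 'I_n * 'I_n | ij.1 != ij.2) zeta (M ij))%E in
  let nu := tau' (c%:E *
    \sum_(ij : 'I_n * 'I_n | ij.1 != ij.2) tau (N ij))%E in
  let eta := tau' (c%:E *
    \sum_(ij : 'I_n * 'I_n | ij.1 != ij.2) tau (H ij - M ij + N ij)%R)%E
    - tau' (c%:E * \sum_(ij : 'I_n * 'I_n | ij.1 != ij.2) tau (N ij))%E in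
  is_pfn (pfibm T tau p q a) /\
  pfibm T tau p q a =
    PFTriple (tau' (r%:E * tau mu)%E)
      (tau' (r%:E * tau (eta + mu)%R)%E - tau' (r%:E * tau mu)%E)
      (zeta' (r%:E * zeta nu)%E).
Proof.
move=> zeta tau' zeta' c r M H N mu nu eta.
have tT := strict_tnorm_tnorm hT.
have p0 := ltW hp; have q0 := ltW hq.
have c0 : 0 <= c by rewrite invr_ge0 ler0n.
have r0 : 0 <= r by rewrite invr_ge0 addr_ge0.
pose f ij := PFTriple (M ij) (H ij - M ij) (N ij).
have fE ij : pf_mul T (pf_pow tau (a ij.1) p) (pf_pow tau (a ij.2) q) = f ij.
  exact: (pf_mul_pow htau).
(* Closure of the operations is transported along [fE], which avoids estimating [M], [H] and [N]
   directly. *)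
have hf ij : is_pfn (f ij).
  by rewrite -fE; apply: is_pfn_mul => //; apply: (is_pfn_pow htau).
have [pfnB muB enB nuB] := generator_sum htau tT
  (index_enum ('I_n * 'I_n)%type) (fun ij => ij.1 != ij.2) hf.
rewrite /pfibm (eq_bigr _ (fun ij _ => fE ij)); split.
  by apply: (is_pfn_pow htau) => //; apply: (is_pfn_scale htau).
(* The scaling sees the iterated sum only through the three generator values just computed; what
   remains is the definition of [pf_pow]. *)
by rewrite [in LHS]/pf_scale muB enB nuB.
Qed.
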